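(* Consider a trajectory $(x(t),y(t),z(t))$ of the Lorenz system $$\frac{dx}{dt}=10(y-x),\qquad \frac{dy}{dt}=28x-y-xz,\qquad \frac{dz}{dt}=-\tfrac{8}{3}z+xy$$ which is real for real values of $t$; in particular, the state $(x(0),y(0),z(0))$ at $t=0$ is in $\mathbb{R}^3$. Then there is no singularity at any finite real value of $t$, and the solution is defined for all real values of $t$ (both positive and negative). *)

(* Defs.v *)
From Stdlib Require Import Reals.
From Coquelicot Require Import Coquelicot.
Open Scope R_scope.

Definition in_interval (a b : Rbar) (t : R) : Prop := Rbar_lt a t /\ Rbar_lt t b.

Definition lorenz_solution_on (a b : Rbar) (x y z : R -> R) : Prop :=
  forall t : R, in_interval a b t ->
    is_derive x t (10 * (y t - x t)) /\
    is_derive y t (28 * x t - y t - x t * z t) /\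
    is_derive z t (- (8 / 3) * z t + x t * y t).

Definition analytic_at (F : C -> C) (w0 : C) : Prop :=
  exists (c : nat -> C) (r : R), 0 < r /\
    forall w : C, Cmod (w - w0)%C < r ->
      @is_pseries C_AbsRing C_NormedModule c (w - w0)%C (F w).

(* Singularities of a solution are singularities in the complex time plane: the
   real time t0 is regular when f is, near t0, the restriction to the real axis
   of a complex function which is analytic at t0. *)
Definition regular_at (f : R -> R) (t0 : R) : Prop :=
  exists F : C -> C, analytic_at F (RtoC t0) /\
    locally t0 (fun t : R => F (RtoC t) = RtoC (f t)).

Definition singular_at (f : R -> R) (t0 : R) : Prop := ~ regular_at f t0.

(* Main.v *)
(** A vector field that is quadratic has local solutions given by power series:
    if the initial state is bounded by [M], the Taylor coefficients are bounded by
    [M (29 + M)^n], so the series converges, in the complex plane as well, on a disc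
    of radius at least [1 / (29 + M)] that depends only on [M].  The function
    [E = x^2 + y^2 + (z - 38)^2 + 1] satisfies [|E'| <= 108 E] along solutions, so
    it grows at most exponentially both forwards and backwards in time.  On
    [[-T, T]] the local solutions therefore exist for a uniform time, and finitely
    many of them, glued by uniqueness, cover the interval. *)

Require Import Defs.
From Stdlib Require Import Reals Lra Lia Psatz ClassicalEpsilon.
From Coquelicot Require Import Coquelicot.
Open Scope R_scope.

(** * State-valued curves and the Lorenz equations at a single time *)

Definition px (p : R * R * R) : R := fst (fst p).
Definition py (p : R * R * R) : R := snd (fst p).
Definition pz (p : R * R * R) : R := snd p.

Definition in_cube (M : R) (p : R * R * R) : Prop :=
  Rabs (px p) <= M /\ Rabs (py p) <= M /\ Rabs (pz p) <= M.

Definition lorenz_at (u : R -> R * R * R) (t : R) : Prop :=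
  is_derive (fun s => px (u s)) t (10 * (py (u t) - px (u t))) /\
  is_derive (fun s => py (u s)) t
    (28 * px (u t) - py (u t) - px (u t) * pz (u t)) /\
  is_derive (fun s => pz (u s)) t
    (- (8 / 3) * pz (u t) + px (u t) * py (u t)).

Lemma lorenz_at_ext_loc (u v : R -> R * R * R) (t : R) :
  locally t (fun s => u s = v s) -> lorenz_at u t -> lorenz_at v t.
Proof.
intros E (H1 & H2 & H3).
assert (E0 : u t = v t) by exact (locally_singleton _ _ E).
unfold lorenz_at; rewrite <- E0.
split; [ | split ];
  [ refine (is_derive_ext_loc _ (fun s => px (v s)) _ _ _ H1)
  | refine (is_derive_ext_loc _ (fun s => py (v s)) _ _ _ H2)
  | refine (is_derive_ext_loc _ (fun s => pz (v s)) _ _ _ H3) ];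
  revert E; apply filter_imp; intros s Es; now rewrite Es.
Qed.

(** The system is autonomous, so translating time preserves solutions. *)
Lemma lorenz_at_shift (u : R -> R * R * R) (c t : R) :
  lorenz_at u (t - c) -> lorenz_at (fun s => u (s - c)) t.
Proof.
assert (S : forall (f : R -> R) l, is_derive f (t - c) l ->
  is_derive (fun s => f (s - c)) t l).
{ intros f l H.
  replace l with (scal 1 l) by (unfold scal; simpl; unfold mult; simpl; ring).
  apply (is_derive_comp f (fun s => s - c) t l 1 H).
  auto_derive; [ exact I | ring ]. }
intros (H1 & H2 & H3).
split; [ | split ];
  [ apply (S (fun s => px (u s))) | apply (S (fun s => py (u s)))
  | apply (S (fun s => pz (u s))) ]; assumption.
Qed.

(** * Growth estimates and uniqueness *)

(** With [sg] the direction from [p] to [t], multiplying [f] by [exp (- sg * L * (s - p))] gives a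
    function whose value at [t] is, by the mean value theorem, at most its value at [p]. The sign
    treats both directions of time at once. *)
Lemma gronwall (f df : R -> R) (p t L : R) :
  (forall s, Rmin p t <= s <= Rmax p t ->
    is_derive f s (df s) /\ Rabs (df s) <= L * f s) ->
  f t <= f p * exp (L * Rabs (t - p)).
Proof.
intros H.
assert (Hs : exists sg, sg * (t - p) = Rabs (t - p) /\ Rabs sg = 1).
{ destruct (Rle_dec 0 (t - p)).
  - exists 1; rewrite !Rabs_right; lra.
  - exists (-1); rewrite !Rabs_left; lra. }
destruct Hs as (sg & Hsg & Hsg1).
set (g := fun s => f s * exp (- sg * L * (s - p))).
set (dg := fun s => (df s - sg * L * f s) * exp (- sg * L * (s - p))).
assert (D : forall s, Rmin p t <= s <= Rmax p t -> is_derive g s (dg s)).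
{ intros s Is; destruct (H s Is) as [Hd _]; unfold g, dg.
  auto_derive; [ exists (df s); exact Hd | ].
  replace (Derive (fun x => f x) s) with (df s)
    by (symmetry; apply is_derive_unique, Hd).
  replace (s + - p) with (s - p) by ring. ring. }
destruct (MVT_gen g p t dg) as (c & Ic & Hc).
- intros s Is; apply D; lra.
- intros s Is. apply continuity_pt_filterlim.
  apply (ex_derive_continuous g); exists (dg s); apply D, Is.
- destruct (H c Ic) as [_ Hb].
  assert (Hneg : dg c * (t - p) <= 0).
  { unfold dg.
    pose proof (exp_pos (- sg * L * (c - p))) as He.
    replace ((df c - sg * L * f c) * exp (- sg * L * (c - p)) * (t - p))
      with ((df c * (t - p) - L * f c * (sg * (t - p)))
            * exp (- sg * L * (c - p))) by ring.
    rewrite Hsg.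
    assert (df c * (t - p) <= L * f c * Rabs (t - p)).
    { apply Rle_trans with (Rabs (df c * (t - p))); [ apply Rle_abs | ].
      rewrite Rabs_mult. apply Rmult_le_compat_r; [ apply Rabs_pos | exact Hb ]. }
    nra. }
  assert (Hg : g t <= g p) by lra.
  unfold g in Hg.
  replace (- sg * L * (p - p)) with 0 in Hg by ring. rewrite exp_0 in Hg.
  replace (- sg * L * (t - p)) with (- (L * Rabs (t - p))) in Hg
    by (rewrite <- Hsg; ring).
  rewrite exp_Ropp in Hg.
  pose proof (exp_pos (L * Rabs (t - p))) as He.
  replace (f t) with (f t * / exp (L * Rabs (t - p)) * exp (L * Rabs (t - p)))
    by (field; lra).
  apply Rmult_le_compat_r; lra.
Qed.

(** The centre is 38 = 28 + 10. The summand 1 keeps the energy positive and lets it dominate terms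
    linear in [z - 38]. *)
Definition energy (p : R * R * R) : R :=
  px p ^ 2 + py p ^ 2 + (pz p - 38) ^ 2 + 1.

Lemma is_derive_sum_sqr (f g h : R -> R) (t df dg dh : R) :
  is_derive f t df -> is_derive g t dg -> is_derive h t dh ->
  is_derive (fun s => f s ^ 2 + g s ^ 2 + h s ^ 2) t
    (2 * (f t * df + g t * dg + h t * dh)).
Proof.
intros Hf Hg Hh. auto_derive.
- repeat apply conj; try exact I;
    [ exists df | exists dg | exists dh ]; assumption.
- replace (Derive (fun x => f x) t) with df
    by (symmetry; apply is_derive_unique, Hf).
  replace (Derive (fun x => g x) t) with dg
    by (symmetry; apply is_derive_unique, Hg).
  replace (Derive (fun x => h x) t) with dh
    by (symmetry; apply is_derive_unique, Hh).
  ring.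
Qed.

(* With the centre [z = 38] the terms [x y] and [x y z] cancel in the derivative
   of the energy, leaving a quadratic form plus a linear term. *)
Lemma energy_growth (u : R -> R * R * R) (p t : R) :
  (forall s, Rmin p t <= s <= Rmax p t -> lorenz_at u s) ->
  energy (u t) <= energy (u p) * exp (108 * Rabs (t - p)).
Proof.
intros H.
apply (gronwall (fun s => energy (u s))
  (fun s => -2 * (10 * px (u s) ^ 2 + py (u s) ^ 2 + 8 / 3 * (pz (u s) - 38) ^ 2
     + 304 / 3 * (pz (u s) - 38)))).
intros s Is. destruct (H s Is) as (H1 & H2 & H3).
split.
- replace (-2 * _) with (2 * (px (u s) * (10 * (py (u s) - px (u s)))
    + py (u s) * (28 * px (u s) - py (u s) - px (u s) * pz (u s))
    + (pz (u s) - 38) * (- (8 / 3) * pz (u s) + px (u s) * py (u s) - 0)) + 0)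
    by field.
  apply (is_derive_plus (fun r => px (u r) ^ 2 + py (u r) ^ 2
    + (pz (u r) - 38) ^ 2) (fun _ => 1)); [ | apply @is_derive_const ].
  apply (is_derive_sum_sqr (fun r => px (u r)) (fun r => py (u r))
    (fun r => pz (u r) - 38)); [ exact H1 | exact H2 | ].
  apply (is_derive_minus (fun r => pz (u r)) (fun _ => 38));
    [ exact H3 | apply @is_derive_const ].
- unfold energy. apply Rabs_le.
  pose proof (pow2_ge_0 (px (u s))). pose proof (pow2_ge_0 (py (u s))).
  pose proof (pow2_ge_0 (pz (u s) - 38)).
  (* These two squares give [2 |r| <= r^2 + 1] for [r = z - 38], so the coefficient of [r^2] is at
     most 16/3 + 304/3 < 108. *)
  pose proof (pow2_ge_0 (pz (u s) - 38 - 1)).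
  pose proof (pow2_ge_0 (pz (u s) - 38 + 1)).
  split; nra.
Qed.

(** Each of [x], [y], [z - 38] obeys [|r| <= r^2 + 1]; the added 38 undoes the shift of [z]. *)
Lemma in_cube_energy (p : R * R * R) : in_cube (energy p + 38) p.
Proof.
unfold in_cube, energy.
pose proof (pow2_ge_0 (px p)). pose proof (pow2_ge_0 (py p)).
pose proof (pow2_ge_0 (pz p - 38)).
repeat split; apply Rabs_le; split; nra.
Qed.

Lemma in_cube_le (M N : R) (p : R * R * R) : M <= N -> in_cube M p -> in_cube N p.
Proof. unfold in_cube; intros; lra. Qed.

Lemma between_dist (p t s : R) :
  Rmin p t <= s <= Rmax p t -> Rabs (s - p) <= Rabs (t - p).
Proof.
unfold Rmin, Rmax, Rabs; destruct (Rle_dec p t);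
  destruct (Rcase_abs (s - p)); destruct (Rcase_abs (t - p)); lra.
Qed.

Lemma energy_pos (p : R * R * R) : 0 < energy p.
Proof.
unfold energy.
pose proof (pow2_ge_0 (px p)). pose proof (pow2_ge_0 (py p)).
pose proof (pow2_ge_0 (pz p - 38)). lra.
Qed.

(** The bound depends only on the state at [p] and on the elapsed time; this rules out blow-up in
    finite time. *)
Lemma apriori_bound (u : R -> R * R * R) (p t : R) :
  (forall s, Rmin p t <= s <= Rmax p t -> lorenz_at u s) ->
  in_cube (energy (u p) * exp (108 * Rabs (t - p)) + 38) (u t).
Proof.
intros H. eapply in_cube_le; [ | apply in_cube_energy ].
pose proof (energy_growth u p t H). lra.
Qed.

(** Gronwall's inequality applies to the squared distance [q], which vanishes at [p]. The constant
    is uniform because the a priori bound confines [u] to one cube over the whole interval. *)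
Lemma lorenz_unique (u v : R -> R * R * R) (p t : R) :
  (forall s, Rmin p t <= s <= Rmax p t -> lorenz_at u s /\ lorenz_at v s) ->
  u p = v p -> u t = v t.
Proof.
intros H E.
set (M := energy (u p) * exp (108 * Rabs (t - p)) + 38).
assert (B : forall s, Rmin p t <= s <= Rmax p t -> in_cube M (u s)).
{ intros s Is.
  apply in_cube_le with (2 := apriori_bound u p s
    (fun r Ir => proj1 (H r ltac:(revert Is Ir; clear; unfold Rmin, Rmax;
       destruct (Rle_dec p t); destruct (Rle_dec p s); lra)))).
  unfold M. apply Rplus_le_compat_r, Rmult_le_compat_l;
    [ apply Rlt_le, energy_pos | ].
  pose proof (between_dist p t s Is) as [Hl | He].
  - apply Rlt_le, exp_increasing; lra.
  - rewrite He; lra. }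
set (q := fun s => (px (u s) - px (v s)) ^ 2 + (py (u s) - py (v s)) ^ 2
   + (pz (u s) - pz (v s)) ^ 2).
(* In the derivative of [q] the terms containing [px (v s)] cancel, so the bound on [u] suffices.
   Splitting products by [|r1 r2| <= (r1^2 + r2^2) / 2], the largest coefficient, that of the
   squared [x] difference, is twice 10 + 38/2 + M = 29 + M. *)
assert (G : q t <= q p * exp (2 * (29 + M) * Rabs (t - p))).
{ apply gronwall with (df := fun s => 2 * (
    -10 * (px (u s) - px (v s)) ^ 2
    + 38 * (px (u s) - px (v s)) * (py (u s) - py (v s))
    - (py (u s) - py (v s)) ^ 2 - 8 / 3 * (pz (u s) - pz (v s)) ^ 2
    - pz (u s) * ((px (u s) - px (v s)) * (py (u s) - py (v s)))
    + py (u s) * ((px (u s) - px (v s)) * (pz (u s) - pz (v s))))).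
  intros s Is. destruct (H s Is) as ((H1 & H2 & H3) & (K1 & K2 & K3)).
  split.
  - unfold q.
    replace (2 * _) with (2 *
      ((px (u s) - px (v s)) * (10 * (py (u s) - px (u s))
         - 10 * (py (v s) - px (v s)))
      + (py (u s) - py (v s)) * ((28 * px (u s) - py (u s) - px (u s) * pz (u s))
         - (28 * px (v s) - py (v s) - px (v s) * pz (v s)))
      + (pz (u s) - pz (v s)) * ((- (8 / 3) * pz (u s) + px (u s) * py (u s))
         - (- (8 / 3) * pz (v s) + px (v s) * py (v s))))) by field.
    apply (is_derive_sum_sqr (fun r => px (u r) - px (v r))
      (fun r => py (u r) - py (v r)) (fun r => pz (u r) - pz (v r)));
      [ apply (is_derive_minus (fun r => px (u r)) (fun r => px (v r)))
      | apply (is_derive_minus (fun r => py (u r)) (fun r => py (v r)))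
      | apply (is_derive_minus (fun r => pz (u r)) (fun r => pz (v r))) ];
      assumption.
  - destruct (B s Is) as (_ & By & Bz). unfold q. clear - By Bz.
    set (d := px (u s) - px (v s)). set (e := py (u s) - py (v s)).
    set (g := pz (u s) - pz (v s)).
    assert (AG : forall r1 r2, Rabs (r1 * r2) <= (r1 ^ 2 + r2 ^ 2) / 2).
    { intros r1 r2. pose proof (pow2_ge_0 (r1 - r2)).
      pose proof (pow2_ge_0 (r1 + r2)). apply Rabs_le; split; lra. }
    assert (Y : Rabs (py (u s) * (d * g)) <= M * ((d ^ 2 + g ^ 2) / 2))
      by (rewrite Rabs_mult; apply Rmult_le_compat; auto using Rabs_pos).
    assert (Z : Rabs (pz (u s) * (d * e)) <= M * ((d ^ 2 + e ^ 2) / 2))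
      by (rewrite Rabs_mult; apply Rmult_le_compat; auto using Rabs_pos).
    pose proof (AG d e) as W.
    assert (HM : 0 <= M) by (pose proof (Rabs_pos (py (u s))); lra).
    apply Rabs_le_between in W, Y, Z.
    pose proof (pow2_ge_0 d). pose proof (pow2_ge_0 e). pose proof (pow2_ge_0 g).
    pose proof (Rmult_le_pos M _ HM (pow2_ge_0 e)).
    pose proof (Rmult_le_pos M _ HM (pow2_ge_0 g)).
    apply Rabs_le; split; lra. }
assert (Q0 : q p = 0) by (unfold q; rewrite E; ring).
rewrite Q0, Rmult_0_l in G. unfold q in G.
pose proof (pow2_ge_0 (px (u t) - px (v t))).
pose proof (pow2_ge_0 (py (u t) - py (v t))).
pose proof (pow2_ge_0 (pz (u t) - pz (v t))).
assert (S : forall r, r ^ 2 <= 0 -> r = 0).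
{ intros r Hr. destruct (Req_dec r 0) as [ | Hn ]; [ assumption | ].
  pose proof (pow2_gt_0 r Hn). lra. }
assert (E1 := S (px (u t) - px (v t)) ltac:(lra)).
assert (E2 := S (py (u t) - py (v t)) ltac:(lra)).
assert (E3 := S (pz (u t) - pz (v t)) ltac:(lra)).
destruct (u t) as [[? ?] ?], (v t) as [[? ?] ?]; unfold px, py, pz in *; simpl in *.
repeat f_equal; lra.
Qed.

(** * Power series solutions and their radius of convergence *)

(** Comparing coefficients of [t^n] in the equations gives this recurrence; [PS_mult] is the Cauchy
    product. *)
Definition series_step (u : nat -> R * R * R) (n : nat) : R * R * R :=
  let a k := px (u k) in
  let b k := py (u k) in
  let c k := pz (u k) in
  (10 * (b n - a n) / INR (S n),
   (28 * a n - b n - PS_mult a c n) / INR (S n),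
   (- (8 / 3) * c n + PS_mult a b n) / INR (S n)).

(* [series_step _ n] reads all the coefficients up to [n], so the recursion
   carries the whole prefix as a function (meaningful up to index [n]). *)
Fixpoint coef_upto (p : R * R * R) (n : nat) : nat -> R * R * R :=
  match n with
  | O => fun _ => p
  | S m => fun k =>
      if (k <=? m)%nat then coef_upto p m k else series_step (coef_upto p m) m
  end.

Definition coef (p : R * R * R) (n : nat) : R * R * R := coef_upto p n n.

Lemma coef_upto_eq (p : R * R * R) (n k : nat) :
  (k <= n)%nat -> coef_upto p n k = coef p k.
Proof.
induction n as [ | n IH ]; intros Hk.
- now replace k with 0%nat by lia.
- destruct (Nat.eq_dec k (S n)) as [ -> | Hne ]; [ reflexivity | ].
  simpl. rewrite (proj2 (Nat.leb_le k n)) by lia. apply IH; lia.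
Qed.

Lemma PS_mult_ext_le (a a' b b' : nat -> R) (n : nat) :
  (forall k, (k <= n)%nat -> a k = a' k) ->
  (forall k, (k <= n)%nat -> b k = b' k) -> PS_mult a b n = PS_mult a' b' n.
Proof.
intros Ha Hb. apply sum_eq; intros k Hk. rewrite Ha, Hb by lia. reflexivity.
Qed.

(** The step reads only indices up to [n], where the stored prefix agrees with [coef]. *)
Lemma coef_S (p : R * R * R) (n : nat) : coef p (S n) = series_step (coef p) n.
Proof.
change (coef p (S n)) with (if (S n <=? n)%nat then coef_upto p n (S n)
  else series_step (coef_upto p n) n).
rewrite (proj2 (Nat.leb_gt (S n) n)) by lia.
assert (E : forall k, (k <= n)%nat -> coef_upto p n k = coef p k)
  by (intros; apply coef_upto_eq; assumption).
unfold series_step. rewrite (E n) by lia.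
rewrite (PS_mult_ext_le (fun k => px (coef_upto p n k)) (fun k => px (coef p k))
  (fun k => pz (coef_upto p n k)) (fun k => pz (coef p k)))
  by (intros; rewrite E; auto).
rewrite (PS_mult_ext_le (fun k => px (coef_upto p n k)) (fun k => px (coef p k))
  (fun k => py (coef_upto p n k)) (fun k => py (coef p k)))
  by (intros; rewrite E; auto).
reflexivity.
Qed.

(** The exponents in each of the [S n] products add up to [n]. The factor [INR (S n)] is later
    cancelled by the denominator in [series_step]. *)
Lemma PS_mult_bound (a b : nat -> R) (A K : R) (n : nat) :
  (forall k, (k <= n)%nat -> Rabs (a k) <= A * K ^ k) ->
  (forall k, (k <= n)%nat -> Rabs (b k) <= A * K ^ k) ->
  Rabs (PS_mult a b n) <= INR (S n) * (A * (A * K ^ n)).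
Proof.
intros Ha Hb. unfold PS_mult.
eapply Rle_trans; [ apply Rsum_abs | ].
rewrite Rmult_comm, <- sum_cte. apply sum_Rle; intros k Hk.
rewrite Rabs_mult.
replace (A * (A * K ^ n)) with (A * K ^ k * (A * K ^ (n - k))).
- apply Rmult_le_compat; try apply Rabs_pos; [ apply Ha | apply Hb ]; lia.
- replace (K ^ n) with (K ^ k * K ^ (n - k)) by (rewrite <- pow_add; f_equal; lia).
  ring.
Qed.

Lemma in_cube_nonneg (M : R) (p : R * R * R) : in_cube M p -> 0 <= M.
Proof. intros [H _]. pose proof (Rabs_pos (px p)); lra. Qed.

(** Strong induction. With [q = M * (29 + M) ^ n], the linear terms contribute at most (28 + 1) q
    and the Cauchy product at most [INR (S n) * (M * q)]; dividing by [INR (S n)] leaves at most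
    [(29 + M) * q]. *)
Lemma coef_bound (M : R) (p : R * R * R) (n : nat) :
  in_cube M p -> in_cube (M * (29 + M) ^ n) (coef p n).
Proof.
intros Hp. pose proof (in_cube_nonneg M p Hp) as HM.
induction n as [ n IH ] using (well_founded_induction Wf_nat.lt_wf).
destruct n as [ | n ].
- unfold coef; simpl. rewrite Rmult_1_r. exact Hp.
- rewrite coef_S.
  pose proof (IH n ltac:(lia)) as (Ha & Hb & Hc).
  assert (Hx : forall k, (k <= n)%nat -> Rabs (px (coef p k)) <= M * (29 + M) ^ k)
    by (intros k Hk; apply (IH k); lia).
  assert (Hy : forall k, (k <= n)%nat -> Rabs (py (coef p k)) <= M * (29 + M) ^ k)
    by (intros k Hk; apply (IH k); lia).
  assert (Hz : forall k, (k <= n)%nat -> Rabs (pz (coef p k)) <= M * (29 + M) ^ k)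
    by (intros k Hk; apply (IH k); lia).
  pose proof (PS_mult_bound _ _ _ _ n Hx Hz) as Hxz.
  pose proof (PS_mult_bound _ _ _ _ n Hx Hy) as Hxy.
  assert (Hn : 1 <= INR (S n)) by (rewrite S_INR; pose proof (pos_INR n); lra).
  replace (M * (29 + M) ^ S n) with ((29 + M) * (M * (29 + M) ^ n))
    by (simpl; ring).
  assert (Hq : 0 <= M * (29 + M) ^ n)
    by (apply Rmult_le_pos; [ | apply pow_le ]; lra).
  set (q := M * (29 + M) ^ n) in *.
  assert (D : forall r, Rabs r <= 29 * q + INR (S n) * (M * q) ->
    Rabs (r / INR (S n)) <= (29 + M) * q).
  { intros r Hr. unfold Rdiv. rewrite Rabs_mult, (Rabs_right (/ _))
      by (apply Rle_ge, Rlt_le, Rinv_0_lt_compat; lra).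
    apply Rmult_le_reg_r with (INR (S n)); [ lra | ].
    rewrite Rmult_assoc, Rinv_l by lra. nra. }
  assert (Hmq : 0 <= INR (S n) * (M * q))
    by (apply Rmult_le_pos; [ lra | apply Rmult_le_pos; lra ]).
  apply Rabs_le_between in Ha, Hb, Hc, Hxz, Hxy.
  unfold series_step, in_cube, px, py, pz in *; cbn [fst snd] in *.
  repeat apply conj; apply D, Rabs_le; lra.
Qed.

Lemma CV_radius_geom (a : nat -> R) (A K t : R) :
  0 < K -> (forall n, Rabs (a n) <= A * K ^ n) -> Rabs t < / K ->
  Rbar_lt (Rabs t) (CV_radius a).
Proof.
intros HK Ha Ht. apply Rbar_lt_le_trans with (/ K); [ exact Ht | ].
apply (proj1 (CV_radius_bounded a)). exists A; intros n.
rewrite Rabs_mult, pow_inv, (Rabs_right (/ _))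
  by (apply Rle_ge, Rlt_le, Rinv_0_lt_compat, pow_lt, HK).
apply Rmult_le_reg_r with (K ^ n); [ apply pow_lt, HK | ].
rewrite Rmult_assoc, Rinv_l by (apply Rgt_not_eq, pow_lt, HK).
rewrite Rmult_1_r. apply Ha.
Qed.

Definition series_traj (p : R * R * R) (t : R) : R * R * R :=
  (PSeries (fun n => px (coef p n)) t, PSeries (fun n => py (coef p n)) t,
   PSeries (fun n => pz (coef p n)) t).

Lemma series_traj_0 (p : R * R * R) : series_traj p 0 = p.
Proof.
unfold series_traj. rewrite !PSeries_0. now destruct p as [[? ?] ?].
Qed.

(** Inside the radius of convergence, series may be differentiated termwise and multiplied by Cauchy
    products, so each equation reduces to the recurrence [coef_S]. *)
Lemma series_traj_lorenz (M : R) (p : R * R * R) (t : R) :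
  in_cube M p -> Rabs t < / (29 + M) -> lorenz_at (series_traj p) t.
Proof.
intros Hp Ht. pose proof (in_cube_nonneg M p Hp) as HM.
set (a := fun n => px (coef p n)). set (b := fun n => py (coef p n)).
set (c := fun n => pz (coef p n)).
assert (Ra : Rbar_lt (Rabs t) (CV_radius a))
  by (apply CV_radius_geom with M (29 + M);
      [ lra | intros n; apply (coef_bound M p n Hp) | exact Ht ]).
assert (Rb : Rbar_lt (Rabs t) (CV_radius b))
  by (apply CV_radius_geom with M (29 + M);
      [ lra | intros n; apply (coef_bound M p n Hp) | exact Ht ]).
assert (Rc : Rbar_lt (Rabs t) (CV_radius c))
  by (apply CV_radius_geom with M (29 + M);
      [ lra | intros n; apply (coef_bound M p n Hp) | exact Ht ]).
pose proof (CV_radius_inside _ _ Ra) as Ea.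
pose proof (CV_radius_inside _ _ Rb) as Eb.
pose proof (CV_radius_inside _ _ Rc) as Ec.
pose proof (ex_pseries_mult a b t Ra Rb) as Eab.
pose proof (ex_pseries_mult a c t Ra Rc) as Eac.
assert (N : forall n, INR (S n) <> 0) by (intros; apply not_0_INR; lia).
assert (Sc : forall (r : R) (f : nat -> R), ex_pseries f t -> ex_pseries (PS_scal r f) t)
  by (intros; apply ex_pseries_scal; [ apply Rmult_comm | assumption ]).
split; [ | split ].
- change (is_derive (PSeries a) t (10 * (PSeries b t - PSeries a t))).
  replace (10 * _) with (PSeries (PS_derive a) t); [ apply is_derive_PSeries, Ra | ].
  rewrite <- PSeries_minus, <- PSeries_scal by assumption.
  apply PSeries_ext; intros n. unfold PS_derive, a at 1. rewrite coef_S.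
  unfold series_step, px at 1, PS_scal, PS_minus, PS_plus, PS_opp; cbn [fst snd].
  change (INR (S n) * (10 * (b n - a n) / INR (S n)) = 10 * (b n + - a n)).
  field. apply N.
- change (is_derive (PSeries b) t
    (28 * PSeries a t - PSeries b t - PSeries a t * PSeries c t)).
  replace (28 * _ - _ - _) with (PSeries (PS_derive b) t);
    [ apply is_derive_PSeries, Rb | ].
  rewrite <- PSeries_mult by assumption.
  rewrite <- PSeries_scal, <- PSeries_minus by auto.
  rewrite <- PSeries_minus by (try apply ex_pseries_minus; auto).
  apply PSeries_ext; intros n. unfold PS_derive, b at 1. rewrite coef_S.
  unfold series_step, py at 1, PS_scal, PS_minus, PS_plus, PS_opp; cbn [fst snd].
  change (INR (S n) * ((28 * a n - b n - PS_mult a c n) / INR (S n))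
    = 28 * a n + - b n + - PS_mult a c n).
  field. apply N.
- change (is_derive (PSeries c) t
    (- (8 / 3) * PSeries c t + PSeries a t * PSeries b t)).
  replace (- (8 / 3) * _ + _) with (PSeries (PS_derive c) t);
    [ apply is_derive_PSeries, Rc | ].
  rewrite <- PSeries_mult by assumption.
  rewrite <- PSeries_scal, <- PSeries_plus by auto.
  apply PSeries_ext; intros n. unfold PS_derive, c at 1. rewrite coef_S.
  unfold series_step, pz at 1, PS_scal, PS_plus; cbn [fst snd].
  change (INR (S n) * ((- (8 / 3) * c n + PS_mult a b n) / INR (S n))
    = - (8 / 3) * c n + PS_mult a b n).
  field. apply N.
Qed.

(** * Complex analyticity of real power series *)

(** The complex partial sums are the images of the real ones, and [RtoC] is continuous. *)
Lemma is_pseries_RtoC (a : nat -> R) (x l : R) :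
  is_pseries a x l ->
  @is_pseries C_AbsRing C_NormedModule (fun n => RtoC (a n)) (RtoC x) (RtoC l).
Proof.
intros H.
apply filterlim_ext with (fun n => RtoC (sum_n (fun k => scal (pow_n x k) (a k)) n)).
- assert (T : forall k, @scal C_AbsRing C_NormedModule
      (@pow_n C_Ring (RtoC x) k) (RtoC (a k)) = RtoC (scal (pow_n x k) (a k))).
  { intros k. change (Cmult (@pow_n C_Ring (RtoC x) k) (RtoC (a k))
      = RtoC (pow_n x k * a k)).
    rewrite RtoC_mult. f_equal.
    induction k as [ | k IH ]; [ reflexivity | ].
    change (Cmult (RtoC x) (@pow_n C_Ring (RtoC x) k) = RtoC (x * pow_n x k)).
    now rewrite IH, RtoC_mult. }
  intros n; induction n as [ | n IH ].
  + rewrite !sum_O. symmetry; apply T.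
  + rewrite !sum_Sn, <- IH.
    change (RtoC (sum_n (fun k => scal (pow_n x k) (a k)) n
        + scal (pow_n x (S n)) (a (S n)))
      = Cplus (RtoC (sum_n (fun k => scal (pow_n x k) (a k)) n))
          (@scal C_AbsRing C_NormedModule (@pow_n C_Ring (RtoC x) (S n))
             (RtoC (a (S n))))).
    rewrite RtoC_plus. f_equal. symmetry; apply T.
- eapply filterlim_comp; [ exact H | ].
  intros P [eps HP]. exists eps; intros y Hy. apply HP.
  split; [ exact Hy | apply ball_center ].
Qed.

(** Comparison with the geometric series of ratio [K * Cmod w < 1], using completeness of the
    complex numbers. *)
Lemma ex_pseries_C_geom (a : nat -> R) (A K : R) (w : C) :
  0 < K -> (forall n, Rabs (a n) <= A * K ^ n) -> Cmod w < / K ->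
  @ex_pseries C_AbsRing C_NormedModule (fun n => RtoC (a n)) w.
Proof.
intros HK Ha Hw.
apply (@ex_series_le C_AbsRing C_CompleteNormedModule _
  (fun n => A * (K * Cmod w) ^ n)).
- intros n.
  change (Cmod (Cmult (@pow_n C_Ring w n) (RtoC (a n))) <= A * (K * Cmod w) ^ n).
  assert (E : Cmod (@pow_n C_Ring w n) = Cmod w ^ n).
  { induction n as [ | n IH ]; [ apply Cmod_1 | ].
    change (Cmod (Cmult w (@pow_n C_Ring w n)) = Cmod w * Cmod w ^ n).
    now rewrite Cmod_mult, IH. }
  rewrite Cmod_mult, E, Cmod_R, Rpow_mult_distr.
  replace (A * (K ^ n * Cmod w ^ n)) with (Cmod w ^ n * (A * K ^ n)) by ring.
  apply Rmult_le_compat_l; [ apply pow_le, Cmod_ge_0 | apply Ha ].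
- apply (ex_series_scal A (fun n => (K * Cmod w) ^ n)). apply ex_series_geom.
  rewrite Rabs_right.
  + apply Rmult_lt_reg_l with (/ K); [ now apply Rinv_0_lt_compat | ].
    rewrite <- Rmult_assoc, Rinv_l by lra. lra.
  + apply Rle_ge, Rmult_le_pos; [ lra | apply Cmod_ge_0 ].
Qed.

Lemma PSeries_regular_at (a : nat -> R) (A K t0 : R) :
  0 < K -> (forall n, Rabs (a n) <= A * K ^ n) ->
  regular_at (fun t => PSeries a (t - t0)) t0.
Proof.
intros HK Ha.
pose proof (Rinv_0_lt_compat K HK) as HiK.
(* [iota] turns the sum of the complex series into a total function; wherever the series converges,
   uniqueness of limits makes [F w] its sum. *)
set (F := fun w : C => iota (fun l : C_CompleteNormedModule =>
  @is_pseries C_AbsRing C_NormedModule (fun n => RtoC (a n))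
     (w - RtoC t0)%C l)).
assert (FE : forall w l, @is_pseries C_AbsRing C_NormedModule
  (fun n => RtoC (a n)) (w - RtoC t0)%C l -> F w = l).
{ intros w l Hl. apply (@iota_filterlim_locally C_AbsRing C_CompleteNormedModule
    nat eventually (Proper_StrongProper _ eventually_filter)). exact Hl. }
exists F; split.
- exists (fun n => RtoC (a n)), (/ K). split; [ exact HiK | ].
  intros w Hw. destruct (ex_pseries_C_geom a A K _ HK Ha Hw) as [l Hl].
  now rewrite (FE w l Hl).
- exists (mkposreal _ HiK). intros t Ht. apply FE. rewrite <- RtoC_minus.
  apply is_pseries_RtoC, PSeries_correct, CV_radius_inside.
  now apply CV_radius_geom with A K.
Qed.

(** * Gluing, continuation and global existence *)

Lemma locally_open_interval (a b t : R) :
  a < t < b -> locally t (fun s => a < s < b).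
Proof.
intros [Ha Hb]. apply filter_and; [ now apply open_gt | now apply open_lt ].
Qed.

(** Both intervals contain [p], so their union is an interval and uniqueness makes [u] and [v] agree
    on the overlap. Near each point the glued curve thus coincides with [u] or with [v]. *)
Lemma lorenz_glue (u v : R -> R * R * R) (a b c d p : R) :
  (forall t, a < t < b -> lorenz_at u t) ->
  (forall t, c < t < d -> lorenz_at v t) ->
  a < p < b -> c < p < d -> u p = v p ->
  exists w, (forall t, a < t < b -> w t = u t) /\
    (forall t, Rmin a c < t < Rmax b d -> lorenz_at w t).
Proof.
intros Hu Hv Hab Hcd E.
assert (O : forall t, a < t < b -> c < t < d -> u t = v t).
{ intros t It Jt. apply lorenz_unique with p; [ | exact E ].
  intros s Is; split; [ apply Hu | apply Hv ];
    revert Is; unfold Rmin, Rmax; destruct (Rle_dec p t); lra. }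
exists (fun t => if Rlt_dec a t then if Rlt_dec t b then u t else v t else v t).
match goal with |- context [lorenz_at ?w0] => set (w := w0) end.
assert (Wu : forall t, a < t < b -> w t = u t)
  by (intros t It; unfold w; destruct (Rlt_dec a t), (Rlt_dec t b); lra || reflexivity).
assert (Wv : forall t, c < t < d -> w t = v t).
{ intros t It; unfold w; destruct (Rlt_dec a t), (Rlt_dec t b); try reflexivity.
  apply O; lra. }
split; [ exact Wu | ].
intros t It.
assert (C : a < t < b \/ c < t < d).
{ revert It; unfold Rmin, Rmax; destruct (Rle_dec a c), (Rle_dec b d);
    destruct (Rlt_dec a t), (Rlt_dec t b); lra. }
destruct C as [C | C].
- apply lorenz_at_ext_loc with u; [ | now apply Hu ].
  apply filter_imp with (2 := locally_open_interval _ _ _ C).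
  intros s Is; symmetry; now apply Wu.
- apply lorenz_at_ext_loc with v; [ | now apply Hv ].
  apply filter_imp with (2 := locally_open_interval _ _ _ C).
  intros s Is; symmetry; now apply Wv.
Qed.

(** The series solution restarted at [c] is glued to [u]; its lifespan depends only on [M]. *)
Lemma lorenz_continue (u : R -> R * R * R) (a b c M : R) :
  (forall t, a < t < b -> lorenz_at u t) -> a < c < b -> in_cube M (u c) ->
  exists w, (forall t, a < t < b -> w t = u t) /\
    (forall t, Rmin a (c - / (29 + M)) < t < Rmax b (c + / (29 + M)) ->
       lorenz_at w t).
Proof.
intros Hu Hc HM.
assert (H : 0 < / (29 + M))
  by (apply Rinv_0_lt_compat; pose proof (in_cube_nonneg _ _ HM); lra).
apply lorenz_glue with (fun t => series_traj (u c) (t - c)) c;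
  [ exact Hu | | exact Hc | lra | ].
- intros t It. apply lorenz_at_shift. apply series_traj_lorenz with M; [ exact HM | ].
  apply Rabs_def1; lra.
- rewrite Rminus_diag_eq by reflexivity. now rewrite series_traj_0.
Qed.

Lemma lorenz_exists_upto (p0 : R * R * R) (T : R) :
  0 < T ->
  exists u, u 0 = p0 /\ forall t, Rabs t <= T -> lorenz_at u t.
Proof.
intros HT.
set (B := energy p0 * exp (108 * T) + 38).
pose proof (energy_pos p0) as Hp.
assert (HE : forall c, Rabs c <= T -> energy p0 * exp (108 * Rabs c) + 38 <= B).
{ intros c Hc. apply Rplus_le_compat_r, Rmult_le_compat_l; [ lra | ].
  destruct Hc as [Hc | ->]; [ apply Rlt_le, exp_increasing | ]; lra. }
assert (HB : 38 < B)
  by (pose proof (Rmult_lt_0_compat _ _ Hp (exp_pos (108 * T))); unfold B; lra).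
assert (Hr : 0 < / (29 + B)) by (apply Rinv_0_lt_compat; lra).
set (r := / (29 + B)) in *.
(* [N] is chosen so that the step [h = T / N] satisfies [2 * h < r], where [r] is a lifespan valid
   for every state in the cube of size [B]. *)
destruct (INR_unbounded (2 * T / r)) as [N HN].
assert (HTr : 0 < 2 * T / r) by (apply Rdiv_lt_0_compat; lra).
set (h := T / INR N).
assert (Hh : 0 < h) by (apply Rdiv_lt_0_compat; lra).
assert (HNh : INR N * h = T) by (unfold h; field; lra).
assert (Hhr : 2 * h < r).
{ apply Rmult_lt_reg_l with (INR N); [ lra | ].
  replace (INR N * (2 * h)) with (2 * T) by (rewrite <- HNh; ring).
  apply Rmult_lt_reg_r with (/ r); [ now apply Rinv_0_lt_compat | ].
  rewrite (Rmult_assoc (INR N)), Rinv_r by lra. unfold Rdiv in HN; lra. }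
(* The interval reaches one step beyond [n * h], so the restarting points [n * h] and [- (n * h)]
   are interior. A restart there reaches past [(n + 2) * h] in absolute value. *)
assert (P : forall n, (n <= N)%nat -> exists u, u 0 = p0 /\
  forall t, - (INR (S n) * h) < t < INR (S n) * h -> lorenz_at u t).
{ induction n as [ | n IH ]; intros Hn.
  - exists (series_traj p0); split; [ apply series_traj_0 | ].
    intros t Ht. simpl in Ht. apply series_traj_lorenz with B.
    + apply in_cube_le with (2 := in_cube_energy p0).
      pose proof (HE 0) as H0. rewrite Rabs_R0, Rmult_0_r, exp_0 in H0. lra.
    + apply Rabs_def1; fold r; lra.
  - destruct (IH ltac:(lia)) as (u & Hu0 & Hu).
    assert (HnT : INR n * h <= T).
    { rewrite <- HNh. apply Rmult_le_compat_r; [ lra | apply le_INR; lia ]. }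
    assert (Hn0 : 0 <= INR n * h) by (apply Rmult_le_pos; [ apply pos_INR | lra ]).
    rewrite !S_INR in *. set (c := INR n * h) in *.
    replace ((INR n + 1) * h) with (c + h) in Hu by (unfold c; ring).
    replace ((INR n + 1 + 1) * h) with (c + 2 * h) by (unfold c; ring).
    assert (Bd : forall v, v 0 = p0 ->
      (forall t, - (c + h) < t < c + h -> lorenz_at v t) ->
      forall e, Rabs e = c -> in_cube B (v e)).
    { intros v Hv0 Hv e He.
      apply in_cube_le with (energy (v 0) * exp (108 * Rabs (e - 0)) + 38).
      - rewrite Hv0, Rminus_0_r. apply HE; lra.
      - apply apriori_bound. intros s Is. apply Hv.
        apply between_dist in Is. rewrite !Rminus_0_r, He in Is.
        apply Rabs_le_between in Is. lra. }
    (* First the right end is extended from [c], then the left end from [- c]. *)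
    destruct (lorenz_continue u (- (c + h)) (c + h) c B Hu ltac:(lra)) as (v & Ev & Hv).
    { apply Bd; [ assumption | assumption | apply Rabs_right; lra ]. }
    assert (Hv2 : forall t, - (c + h) < t < c + 2 * h -> lorenz_at v t).
    { intros t Ht. apply Hv. fold r. split.
      - eapply Rle_lt_trans; [ apply Rmin_l | lra ].
      - eapply Rlt_le_trans; [ | apply Rmax_r ]; lra. }
    destruct (lorenz_continue v (- (c + h)) (c + 2 * h) (- c) B Hv2 ltac:(lra))
      as (w & Ew & Hw).
    { apply Bd; [ rewrite Ev by lra; assumption | intros; apply Hv2; lra | ].
      rewrite Rabs_Ropp; apply Rabs_right; lra. }
    exists w; split.
    + rewrite Ew, Ev by lra. exact Hu0.
    + intros t Ht; apply Hw. fold r. split.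
      * eapply Rle_lt_trans; [ apply Rmin_r | lra ].
      * eapply Rlt_le_trans; [ | apply Rmax_l ]; lra. }
destruct (P N (le_n N)) as (u & Hu0 & Hu).
exists u; split; [ exact Hu0 | ].
intros t Ht. apply Hu. apply Rabs_le_between in Ht.
rewrite S_INR. replace ((INR N + 1) * h) with (T + h) by (rewrite <- HNh; ring).
lra.
Qed.

(** A diagonal choice: the value at [t] comes from a solution chosen on the times of absolute value
    at most [|t| + 1]. By uniqueness these solutions agree where they overlap. *)
Lemma lorenz_exists_global (p0 : R * R * R) :
  exists u, u 0 = p0 /\ forall t, lorenz_at u t.
Proof.
assert (HT : forall t, 0 < Rabs t + 1) by (intros t; pose proof (Rabs_pos t); lra).
set (U := fun t => constructive_indefinite_description _
  (lorenz_exists_upto p0 (Rabs t + 1) (HT t))).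
exists (fun t => proj1_sig (U t) t); split; [ exact (proj1 (proj2_sig (U 0))) | ].
intros t.
(* This solution is valid up to absolute time [|t| + 2], hence on the whole unit neighbourhood of
   [t]. *)
destruct (proj2_sig (U (Rabs t + 1))) as [V0 VL].
set (v := proj1_sig (U (Rabs t + 1))) in *.
rewrite Rabs_right in VL by (pose proof (HT t); lra).
apply lorenz_at_ext_loc with v; [ | apply VL; lra ].
exists (mkposreal 1 Rlt_0_1). intros s Hs.
change (Rabs (s - t) < 1) in Hs.
destruct (proj2_sig (U s)) as [W0 WL].
apply lorenz_unique with 0; [ | now rewrite V0, W0 ].
intros r Ir. apply between_dist in Ir. rewrite !Rminus_0_r in Ir.
pose proof (Rabs_triang_inv s t) as Ht.
split; [ apply VL | apply WL ]; lra.
Qed.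

(** By uniqueness [u] coincides near [t0] with the series solution started from [u t0], whose
    coefficients grow at most geometrically. *)
Lemma lorenz_regular (u : R -> R * R * R) (t0 : R) :
  (forall t, lorenz_at u t) ->
  regular_at (fun t => px (u t)) t0 /\ regular_at (fun t => py (u t)) t0 /\
  regular_at (fun t => pz (u t)) t0.
Proof.
intros Hu.
set (M := energy (u t0) + 38).
pose proof (in_cube_energy (u t0)) as HM. fold M in HM.
pose proof (in_cube_nonneg _ _ HM) as HM0.
assert (Hr : 0 < / (29 + M)) by (apply Rinv_0_lt_compat; lra).
assert (L : locally t0 (fun t => series_traj (u t0) (t - t0) = u t)).
{ exists (mkposreal _ Hr). intros t Ht. change (Rabs (t - t0) < / (29 + M)) in Ht.
  apply lorenz_unique with (u := fun s => series_traj (u t0) (s - t0)) (p := t0).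
  - intros s Is. split; [ | apply Hu ]. apply lorenz_at_shift.
    apply series_traj_lorenz with M; [ exact HM | ].
    apply between_dist in Is. lra.
  - rewrite Rminus_diag_eq by reflexivity. apply series_traj_0. }
assert (Tr : forall q : R * R * R -> R,
  regular_at (fun t => q (series_traj (u t0) (t - t0))) t0 ->
  regular_at (fun t => q (u t)) t0).
{ intros q (F & HF & HL). exists F; split; [ exact HF | ].
  apply filter_imp with (2 := filter_and _ _ HL L).
  intros t [E1 E2]. now rewrite E1, E2. }
repeat apply conj; apply Tr, PSeries_regular_at with M (29 + M); try lra;
  intros n; apply (coef_bound M (u t0) n HM).
Qed.

Theorem theorem5p2 (a b : Rbar) (x y z : R -> R)
  (h0 : in_interval a b 0) (hsol : lorenz_solution_on a b x y z) :
  exists X Y Z : R -> R,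
    (forall t : R, in_interval a b t -> X t = x t /\ Y t = y t /\ Z t = z t) /\
    lorenz_solution_on m_infty p_infty X Y Z /\
    (forall t : R, ~ singular_at X t /\ ~ singular_at Y t /\ ~ singular_at Z t).
Proof.
destruct (lorenz_exists_global (x 0, y 0, z 0)) as (u & Hu0 & Hu).
exists (fun t => px (u t)), (fun t => py (u t)), (fun t => pz (u t)).
split; [ | split ].
- intros t Ht.
  (* Both curves have the same state at time 0, and every time between 0 and [t] lies in the given
     interval, so uniqueness applies. *)
  assert (E : u t = (x t, y t, z t)).
  { apply lorenz_unique with (v := fun s => (x s, y s, z s)) (p := 0); [ | exact Hu0 ].
    intros s Is; split; [ apply Hu | apply hsol ].
    revert h0 Ht Is. unfold in_interval, Rmin, Rmax.
    destruct a, b; simpl; destruct (Rle_dec 0 t); lra. }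
  rewrite E. repeat apply conj; reflexivity.
- intros t _. apply Hu.
- intros t. unfold singular_at. pose proof (lorenz_regular u t Hu). tauto.
Qed.
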